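(* Let $G=(V,E,\omega,\mu)$ be an infinite, locally finite, connected weighted graph with $\omega_{\min}>0$ and $D_\mu<+\infty$, let $p>1$, and let $\psi:V\to[0,\infty)$ be bounded and not identically zero. For $\lambda>0$ let $T_\lambda$ be the life span of the solution of $u_t=\Delta u+u^p$ on $V$ with $u(x,0)=\lambda\psi(x)$. Suppose there exist a vertex $\tilde x\in V$ and a constant $\psi_\infty>0$ such that: (EC) for any given $\varepsilon>0$ and $\delta>0$ there exists a finite connected subset $\Omega\subset V$ with $\lambda_1(\Omega)<\varepsilon$ and $d(x,\tilde x)>\delta$ for all $x\in\Omega$; and $\lim_{d(\tilde x,x)\to\infty}\psi(x)=\psi_\infty$. Then: (1) $T_\lambda\le\dfrac{1}{(p-1)\lambda^{p-1}\psi_\infty^{p-1}}$ for all $\lambda>0$. (2) If $\psi(x)\le\psi_\infty$ for all $x\in V$, then $\displaystyle\lim_{\lambda\to0}\lambda^{p-1}T_\lambda=\frac1{(p-1)\psi_\infty^{p-1}}$. (3) $\displaystyle\frac1{(p-1)\|\psi\|_{\ell^\infty(V)}^{p-1}}\le\liminf_{\lambda\to0}\lambda^{p-1}T_\lambda\le\limsup_{\lambda\to0}\lambda^{p-1}T_\lambda\le\frac1{(p-1)\psi_\infty^{p-1}}$.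
   Context: Weighted graph: $V$ is the vertex set, $E$ the edge set, $y\sim x$ means $xy\in E$; $\omega:V\times V\to[0,\infty)$ satisfies $\omega_{xy}=\omega_{yx}$ and $\omega_{xy}>0$ iff $x\sim y$; $\mu:V\to(0,\infty)$. Locally finite means every vertex has finitely many neighbours. Graphs have no loops and no multiple edges. $\omega_{\min}=\inf_{x\sim y}\omega_{xy}$, $d(x,y)$ is the smallest number of edges of a path from $x$ to $y$, and $$\Delta u(x)=\frac1{\mu(x)}\sum_{y\sim x}\omega_{xy}(u(y)-u(x)),\qquad D_\mu=\sup_{x\in V}\frac{1}{\mu(x)}\sum_{y\sim x}\omega_{xy},\qquad \|\psi\|_{\ell^\infty(V)}=\sup_{x\in V}|\psi(x)|.$$ Dirichlet eigenvalue: for a finite connected subset $\Omega\subset V$ let $\partial\Omega=\{x\in\Omega:\exists y\in V\setminus\Omega,\ y\sim x\}$ and $\Omega^\circ=\Omega\setminus\partial\Omega$, which is always assumed nonempty. $\lambda_1(\Omega)$ is the smallest eigenvalue of: $-\Delta_\Omega\phi=\lambda\phi$ on $\Omega^\circ$, $\phi=0$ on $\partial\Omega$, where $\Delta_\Omega\phi(x)=\frac1{\mu(x)}\sum_{y\sim x}\omega_{xy}(\tilde\phi(y)-\tilde\phi(x))$ for $x\in\Omega^\circ$, with $\tilde\phi=\phi$ on $\Omega^\circ$ and $\tilde\phi=0$ on $V\setminus\Omega^\circ$. Solution: a solution in $[0,T)$ of the problem $u_t=\Delta u+u^p$ in $V\times(0,T)$, $u(x,0)=\lambda\psi(x)$ on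 $V$, is a function $u:V\times[0,T)\to[0,\infty)$ satisfying the problem such that for each $x\in V$ the function $u(x,\cdot)$ is continuous on $[0,T)$ and $C^1$ on $(0,T)$, and such that $u$ is bounded on $V\times[0,T']$ for every $0<T'<T$. (A unique local solution exists.) The life span is $T_\lambda=\sup\{T>0:\ \text{the problem has a solution in }[0,T)\}\in(0,\infty]$. *)

(* Defs.v *)
From mathcomp Require Import all_boot all_order all_algebra.
From mathcomp Require Import all_classical all_reals all_analysis.

Set Implicit Arguments.
Unset Strict Implicit.
Unset Printing Implicit Defensive.

Import Order.TTheory GRing.Theory Num.Theory.
Import numFieldNormedType.Exports.

Local Open Scope classical_set_scope.
Local Open Scope ring_scope.

Record wgraph (R : realType) (V : choiceType) := WGraph {
  edge : rel V ;
  weight : V -> V -> R ;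
  mass : V -> R ;
  edge_irrefl : forall x, ~~ edge x x ;
  weight_sym : forall x y, weight x y = weight y x ;
  weight_ge0 : forall x y, 0 <= weight x y ;
  weight_gt0 : forall x y, (0 < weight x y) = edge x y ;
  mass_gt0 : forall x, 0 < mass x
}.

Section Graph.
Context {R : realType} {V : choiceType} (G : wgraph R V).

Definition neighbours (x : V) : set V := [set y | edge G x y].

Definition locally_finite : Prop := forall x, finite_set (neighbours x).

(* [walk x y s] : x :: s lists the vertices of a path from x to y, so the path
   has [size s] edges. *)
Definition walk (x y : V) (s : seq V) : bool := path (edge G) x s && (last x s == y).

Definition connected_in (A : set V) : Prop :=
  forall x y, A x -> A y -> exists s : seq V, walk x y s /\ (forall z, z \in s -> A z).

Definition connected_graph : Prop := connected_in [set: V].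

(* Only meaningful between vertices joined by a path (0 otherwise). *)
Definition dist (x y : V) : nat :=
  if pselect (exists n, `[< exists2 s, walk x y s & size s = n >]) is left h
  then ex_minn h else 0%N.

(* The sums over neighbours below are finitely supported sums: they are the
   intended ones on locally finite graphs. *)
Definition laplacian (f : V -> R) (x : V) : R :=
  (mass G x)^-1 * \sum_(y \in neighbours x) weight G x y * (f y - f x).

Definition omega_min : \bar R :=
  ereal_inf [set (weight G e.1 e.2)%:E | e in [set e : V * V | edge G e.1 e.2]].

Definition D_mu : \bar R :=
  ereal_sup [set ((mass G x)^-1 * \sum_(y \in neighbours x) weight G x y)%:E
            | x in [set: V]].

Definition vboundary (A : set V) : set V :=
  [set x | A x /\ exists2 y, ~ A y & edge G x y].

Definition vinterior (A : set V) : set V := A `\` vboundary A.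

Definition dirichlet_laplacian (A : set V) (phi : V -> R) (x : V) : R :=
  laplacian (patch (fun=> 0) (vinterior A) phi) x.

Definition dirichlet_eigenvalue (A : set V) (l : R) : Prop :=
  exists phi : V -> R,
    [/\ forall x, vinterior A x -> - dirichlet_laplacian A phi x = l * phi x,
        forall x, vboundary A x -> phi x = 0
      & exists2 x, vinterior A x & phi x != 0].

Definition is_lambda1 (A : set V) (l : R) : Prop :=
  dirichlet_eigenvalue A l /\ (forall l', dirichlet_eigenvalue A l' -> l <= l').

Definition EC (x0 : V) : Prop :=
  forall eps delta : R, 0 < eps -> 0 < delta ->
  exists A : set V,
    [/\ finite_set A, connected_in A, vinterior A !=set0,
        (exists2 l, is_lambda1 A l & l < eps)
      & forall x, A x -> delta < (dist x x0)%:R].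

Definition tends_at_infinity (x0 : V) (f : V -> R) (l : R) : Prop :=
  forall eps : R, 0 < eps ->
  exists N : nat, forall x, (N < dist x0 x)%N -> `|f x - l| < eps.

Definition sup_norm (f : V -> R) : R := sup [set `|f x| | x in [set: V]].

(* u is a total function of time; only its values on [0, T[ matter. *)
Definition is_solution (p : R) (u0 : V -> R) (T : R) (u : V -> R -> R) : Prop :=
  [/\ forall x t, 0 <= t < T -> 0 <= u x t,
      forall x, u x 0 = u0 x,
      forall x, {within `[0, T[, continuous (u x)},
      forall x,
        [/\ {in `]0, T[, forall t, derivable (u x) t 1},
            {in `]0, T[, continuous (derive1 (u x))}
          & {in `]0, T[, forall t,
              derive1 (u x) t = laplacian (u ^~ t) x + u x t `^ p}]
    & forall T', 0 < T' < T ->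
        exists M : R, forall x t, 0 <= t <= T' -> u x t <= M].

Definition life_span (p : R) (u0 : V -> R) : \bar R :=
  ereal_sup [set T%:E | T in [set T : R | 0 < T /\ exists u, is_solution p u0 T u]].

End Graph.

(* Main.v *)
Require Import Defs.
From mathcomp Require Import all_boot all_order all_algebra.
From mathcomp Require Import all_classical all_reals all_analysis.
From mathcomp Require Import measurable_realfun.
From mathcomp Require Import ring lra.
Set Implicit Arguments.
Unset Strict Implicit.
Unset Printing Implicit Defensive.
Import Order.TTheory GRing.Theory Num.Theory.
Import numFieldNormedType.Exports.
Local Open Scope classical_set_scope.
Local Open Scope ring_scope.

(* Upper bound (Kaplan's method). If [phi] is a Dirichlet eigenfunction with
   eigenvalue [l < eps] on a finite set far from [x0], then by Kato's inequality
   [g = `|phi|], extended by 0, satisfies [laplacian g >= - eps * g] where [phi]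
   lives, so no positivity of the first eigenfunction is needed. The average [J]
   of [u] with weights proportional to [mass * g] satisfies
   [J' >= - eps * J + J ^ p] by Green's formula and Jensen's inequality, and
   [J 0] is close to [l * psi_oo]. Such a [J] blows up no later than the solution
   of [J' = J ^ p], up to an error that vanishes with [eps].

   Lower bound. With [M = l * sup_norm psi], the solution [m] of [m' = m ^ p],
   [m 0 = M] is a supersolution; a monotone iteration from 0 stays below it and
   converges to a solution of the problem on every compact interval on which [m]
   exists.

   Both bounds are multiples of [l ^ (1 - p)], so they hold for [scaled_T l] at
   every [l > 0] and not only in the limit. *)

(** * A test function from Dirichlet eigenfunctions *)

Lemma weight_non_edge (R : realType) (V : choiceType) (G : wgraph R V) x y :
  ~ edge G x y -> weight G x y = 0.
Proof.
move=> /negP; rewrite -weight_gt0 -leNgt => w0; apply/eqP.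
by rewrite eq_le w0 weight_ge0.
Qed.

(** Weights vanish off the edges, so any duplicate-free list containing the neighbours gives the
    same sum. One list can then serve many vertices at once, which makes double sums symmetric. *)
Lemma sum_neighbours (R : realType) (V : choiceType) (G : wgraph R V) x
  (S : seq V) (F : V -> R) :
  uniq S -> (forall y, edge G x y -> y \in S) ->
  \sum_(y \in neighbours G x) weight G x y * F y =
  \sum_(y <- S) weight G x y * F y.
Proof.
move=> uS NS; rewrite (fsbig_widen (neighbours G x) [set` S])//.
- by rewrite -fsbig_seq.
- by move=> y [_ /= nxy]; rewrite weight_non_edge// mul0r.
Qed.

Lemma laplacian_seq (R : realType) (V : choiceType) (G : wgraph R V) x
  (S : seq V) (f : V -> R) :
  uniq S -> (forall y, edge G x y -> y \in S) ->
  mass G x * laplacian G f x = \sum_(y <- S) weight G x y * (f y - f x).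
Proof.
move=> uS NS; rewrite /laplacian (sum_neighbours (fun y => f y - f x) uS NS).
by rewrite mulrA mulfV ?mul1r// gt_eqF// mass_gt0.
Qed.

Lemma finite_neighbourhood (R : realType) (V : choiceType) (G : wgraph R V)
  (A : set V) : locally_finite G -> finite_set A ->
  exists S : seq V, [/\ uniq S, forall x, A x -> x \in S
    & forall x y, A x -> edge G x y -> y \in S].
Proof.
move=> lf fA.
have fB : finite_set (A `|` \bigcup_(x in A) neighbours G x).
  by rewrite finite_setU; split=> //; apply: bigcup_finite => // x _; exact: lf.
exists (finmap.enum_fset (fset_set (A `|` \bigcup_(x in A) neighbours G x))); split.
- exact: finmap.fset_uniq.
- by move=> x Ax; rewrite in_fset_set// inE; left.
- by move=> x y Ax xy; rewrite in_fset_set// inE; right; exists x.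
Qed.

(* Kato's inequality: [sgr (f x) * (f y - f x) <= `|f y| - `|f x|]. *)
Lemma kato_laplacian (R : realType) (V : choiceType) (G : wgraph R V) (l : R)
  (f : V -> R) x : locally_finite G ->
  - laplacian G f x = l * f x ->
  - (l * `|f x|) <= laplacian G (fun y => `|f y|) x.
Proof.
move=> lf fx.
have [S [uS xS NS]] := @finite_neighbourhood R V G [set x] lf (finite_set1 x).
have {}NS y : edge G x y -> y \in S by exact: NS.
have m0 := mass_gt0 G x.
rewrite -(ler_pM2l m0) (laplacian_seq _ uS NS).
have -> : mass G x * - (l * `|f x|) = Num.sg (f x) * (mass G x * laplacian G f x).
  by rewrite [`|f x|]normrEsg -[laplacian G f x]opprK fx; ring.
rewrite (laplacian_seq _ uS NS) big_distrr/= ler_sum// => y _.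
rewrite mulrCA ler_wpM2l ?weight_ge0// mulrBr -normrEsg lerB//.
rewrite (le_trans (ler_norm _))// normrM -[leRHS]mul1r ler_wpM2r//.
by rewrite normr_sg; case: (f x != 0).
Qed.

(** Summation by parts moves the Laplacian from [u] to [g]. At a vertex of [S] outside [A], [g]
    vanishes and its neighbours contribute nonnegative terms multiplied by [u x >= 0], so the
    boundary terms have the favourable sign and the inequality for [g] is needed on [A] only. *)
Lemma green_test (R : realType) (V : choiceType) (G : wgraph R V) (l : R)
  (A : set V) (S : seq V) (g u : V -> R) :
  uniq S -> (forall x y, A x -> edge G x y -> y \in S) ->
  (forall x, A x -> x \in S) ->
  (forall x, 0 <= g x) -> (forall x, ~ A x -> g x = 0) ->
  (forall x, A x -> - (l * g x) <= laplacian G g x) ->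
  (forall x, 0 <= u x) ->
  - (l * \sum_(x <- S) mass G x * g x * u x) <=
  \sum_(x <- S) mass G x * g x * laplacian G u x.
Proof.
move=> uS NS AS g0 gA gl u0.
have -> : \sum_(x <- S) mass G x * g x * laplacian G u x =
   \sum_(x <- S) u x * \sum_(y <- S) weight G x y * (g y - g x).
  transitivity (\sum_(x <- S) \sum_(y <- S)
     (weight G x y * g x * u y - weight G x y * g x * u x)).
    apply: eq_bigr => x _; have [Ax|/gA gx] := pselect (A x); last first.
      rewrite gx mulr0 mul0r; apply/esym; apply: big1 => y _.
      by rewrite mulr0 !mul0r subr0.
    rewrite mulrAC (laplacian_seq _ uS (fun y => NS x y Ax)) mulr_suml.
    by apply: eq_bigr => y _; ring.
  under eq_bigr do rewrite sumrB.
  rewrite sumrB exchange_big/= -sumrB; apply: eq_bigr => x _.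
  rewrite -sumrB mulr_sumr; apply: eq_bigr => y _.
  by rewrite (weight_sym _ y x); ring.
rewrite mulr_sumr -sumrN ler_sum// => x _.
have [Ax|nAx] := pselect (A x).
  rewrite -(laplacian_seq _ uS (fun y => NS x y Ax)).
  rewrite (_ : - _ = u x * (mass G x * - (l * g x))); last by ring.
  by rewrite ler_wpM2l// ler_wpM2l ?gl// ltW// mass_gt0.
rewrite gA// mulr0 mul0r mulr0 oppr0 mulr_ge0// sumr_ge0// => y _.
by rewrite addr0 mulr_ge0// weight_ge0.
Qed.

Lemma walk_rev (R : realType) (V : choiceType) (G : wgraph R V) x y s :
  walk G x y s -> exists2 s', walk G y x s' & size s' = size s.
Proof.
move=> /andP[px /eqP <-]; exists (rev (belast x s)); last first.
  by rewrite size_rev size_belast.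
apply/andP; split.
  rewrite rev_path (@eq_path _ _ (edge G))// => a b.
  by rewrite -!weight_gt0 weight_sym.
by case: s {px} => //= a s; rewrite rev_cons last_rcons.
Qed.

(** Reconciles [EC], which measures [dist x x0], with [tends_at_infinity], which measures
    [dist x0 x]. *)
Lemma dist_sym (R : realType) (V : choiceType) (G : wgraph R V) x y :
  dist G x y = dist G y x.
Proof.
have walkE a b n : (exists2 s, walk G a b s & size s = n) ->
    exists2 s, walk G b a s & size s = n.
  by move=> [s /walk_rev[s' ? <-] <-]; exists s'.
rewrite /dist; case: pselect => h1; case: pselect => h2 //.
- case: ex_minnP => m /asboolP/walkE/asboolP m1 m2.
  case: ex_minnP => k /asboolP/walkE/asboolP k1 k2.
  by apply/eqP; rewrite eqn_leq m2// k2.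
- by exfalso; case: h1 => n /asboolP/walkE/asboolP hn; apply: h2; exists n.
- by exfalso; case: h2 => n /asboolP/walkE/asboolP hn; apply: h1; exists n.
Qed.

Lemma far_test_function (R : realType) (V : choiceType) (G : wgraph R V) x0
  (eps : R) (n : nat) : locally_finite G -> EC G x0 -> 0 < eps ->
  exists (A : set V) (g : V -> R),
   [/\ finite_set A, forall x, A x -> (n < dist G x0 x)%N,
       (forall x, 0 <= g x) /\ (forall x, ~ A x -> g x = 0),
       exists2 x, A x & 0 < g x
     & forall x, A x -> - (eps * g x) <= laplacian G g x].
Proof.
move=> lf ec eps0.
(* [EC] asks for a positive radius, and [n] may be 0; hence the radius [n.+1]. *)
have [A [fA _ _ [l [[phi [phil _ [z Az phiz]]] _] leps] dA]] :=
  ec eps n.+1%:R eps0 (ltr0Sn _ _).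
pose f := patch (fun=> 0) (vinterior G A) phi.
have fE x : vinterior G A x -> f x = phi x.
  by move=> Ax; rewrite /f patchE mem_set.
exists (vinterior G A), (fun x => `|f x|); split => //.
- by apply: sub_finite_set fA => x [].
- move=> x [Ax _]; have := dA _ Ax; rewrite ltr_nat dist_sym.
  exact: ltn_trans.
- by split=> // x nx; rewrite /f patchE memNset// normr0.
- by exists z => //; rewrite normr_gt0 fE.
- move=> x Ax; apply: (@le_trans _ _ (- (l * `|f x|))).
    by rewrite lerN2 ler_wpM2r// ltW.
  by apply: kato_laplacian => //; rewrite (fE x Ax) -phil.
Qed.

(** * Upper bound for the life span *)

Lemma powR_tangent (R : realType) (p u J : R) : 1 < p -> 0 <= u -> 0 <= J ->
  p * J `^ (p - 1) * u <= u `^ p + (p - 1) * J `^ p.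
Proof.
move=> p1 u0 J0; have p0 : 0 < p by rewrite (lt_trans _ p1).
have q0 : 0 < p - 1 by rewrite subr_gt0.
have := @conjugate_powR _ u (J `^ (p - 1)) p (p / (p - 1)) u0 (powR_ge0 _ _) p0
  (divr_gt0 p0 q0).
rewrite -powRrM (mulrC (p - 1)) (_ : p / (p - 1) * (p - 1) = p); last first.
  by rewrite divfK// gt_eqF.
move=> /(_ _)/(le_trans _).
have -> : p^-1 + (p / (p - 1))^-1 = 1 by field; rewrite !gt_eqF.
move=> /(_ _ (lexx _) erefl); rewrite invf_div -(ler_pM2l p0) => h.
rewrite -mulrA [X in _ * X]mulrC (le_trans h)// le_eqVlt; apply/orP; left.
by apply/eqP; field; rewrite gt_eqF.
Qed.

Lemma jensen_powR (R : realType) (I : Type) (s : seq I) (a u : I -> R) (p : R) :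
  1 < p -> (forall i, 0 <= a i) -> (forall i, 0 <= u i) ->
  \sum_(i <- s) a i = 1 ->
  (\sum_(i <- s) a i * u i) `^ p <= \sum_(i <- s) a i * u i `^ p.
Proof.
move=> p1 a0 u0 sa; set J := \sum_(i <- s) a i * u i.
have J0 : 0 <= J by apply: sumr_ge0 => i _; rewrite mulr_ge0.
have : \sum_(i <- s) a i * (p * J `^ (p - 1) * u i) <=
       \sum_(i <- s) a i * (u i `^ p + (p - 1) * J `^ p).
  by apply: ler_sum => i _; rewrite ler_wpM2l// powR_tangent.
under eq_bigr do rewrite mulrCA.
under [leRHS]eq_bigr do rewrite mulrDr.
rewrite -mulr_sumr -/J big_split/= -mulr_suml sa mul1r.
rewrite -mulrA [_ `^ _ * J]mulrC mulr_powRB1// ?(lt_trans _ p1)//.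
by rewrite mulrBl mul1r; lra.
Qed.

Lemma is_derive1_bigsum (R : realType) (I : Type) (s : seq I)
  (f : I -> R -> R) (df : I -> R) (t : R) :
  (forall i, is_derive t 1 (f i) (df i)) ->
  is_derive t 1 (fun t => \sum_(i <- s) f i t) (\sum_(i <- s) df i).
Proof.
move=> fd; elim: s => [|i s IH].
  rewrite big_nil (_ : (fun _ => _) = cst 0); first exact: is_derive_cst.
  by apply/funext => x; rewrite big_nil.
rewrite big_cons (_ : (fun _ => _) = f i + (fun t => \sum_(j <- s) f j t)).
  exact: is_deriveD.
by apply/funext => x; rewrite big_cons.
Qed.

(* With [K t = J t * expR (eps * t)] and [c = expR (- ((p - 1) * eps * t0))] the
   hypotheses give [K' >= c * K `^ p] on [0, t0], so
   that [K `^ (- (p - 1)) + (p - 1) * c * t] is nonincreasing. *)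
Lemma blowup_time (R : realType) (p eps t0 : R) (J : R -> R) :
  1 < p -> 0 <= eps -> 0 < t0 ->
  {within `[0, t0], continuous J} ->
  {in `]0, t0[, forall t, derivable J t 1} ->
  {in `[0, t0], forall t, 0 <= J t} ->
  {in `]0, t0[, forall t, - (eps * J t) + J t `^ p <= derive1 J t} ->
  0 < J 0 ->
  (p - 1) * t0 * expR (- ((p - 1) * eps * t0)) * J 0 `^ (p - 1) <= 1.
Proof.
move=> p1 eps0 t00 cJ dJ J_ge0 J_ineq J0.
have q0 : 0 < p - 1 by rewrite subr_gt0.
pose E := fun t : R => expR (eps * t).
have dE (t : R) : is_derive t 1 E (eps * E t).
  by rewrite /E; apply: is_derive_eq; rewrite scaler1 mulrC.
have cE : continuous E.
  by move=> t; apply/differentiable_continuous/derivable1_diffP; apply: ex_derive.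
pose K := J * E.
have cK : {within `[0, t0], continuous K}.
  by move=> t; apply: continuousM; [exact: cJ|exact/continuous_subspaceT].
have dK (t : R) : t \in `]0, t0[ -> is_derive t 1 K (E t * (derive1 J t + eps * J t)).
  move=> tt; have dJt : is_derive t 1 J (derive1 J t).
    by rewrite derive1E; apply/derivableP/dJ.
  by apply: is_derive_eq; rewrite /GRing.scale/=; ring.
have dK_ge (t : R) : t \in `]0, t0[ -> E t * J t `^ p <= derive1 K t.
  move=> tt; have /@derive_val := dK t tt; rewrite -derive1E => ->.
  by rewrite ler_wpM2l ?expR_ge0//; have := J_ineq t tt; lra.
have K0 : K 0 = J 0 by rewrite (_ : K 0 = J 0 * expR (eps * 0))// mulr0 expR0 mulr1.
(* Monotonicity keeps [K] above [K 0 > 0], so that its negative power can be differentiated. *)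
have incK : {in `[0, t0] &, {homo K : x y / x <= y}}.
  apply: ger0_derive1_le_cc => //.
    by move=> t /dK[].
  move=> t tt; rewrite (le_trans _ (dK_ge t tt))//.
  by rewrite mulr_ge0 ?expR_ge0 ?powR_ge0.
have in0 : 0 \in `[0, t0] by rewrite in_itv/= lexx ltW.
have in1 : t0 \in `[0, t0] by rewrite in_itv/= lexx ltW.
have Kgt0 (t : R) : t \in `[0, t0] -> 0 < K t.
  move=> tt; rewrite (lt_le_trans _ (incK _ _ in0 tt _))// ?K0//.
  by move: tt; rewrite in_itv/= => /andP[].
pose c := expR (- ((p - 1) * eps * t0)).
pose Z := fun t => K t `^ (- (p - 1)) + (p - 1) * c * t.
have dZ (t : R) : t \in `]0, t0[ -> is_derive t 1 Z
    (- (p - 1) * K t `^ (- p) * derive1 K t + (p - 1) * c).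
  move=> tt; have Kt : 0 < K t by apply: Kgt0; exact: subset_itv_oo_cc tt.
  have dKt : is_derive t 1 K (derive1 K t).
    by rewrite derive1E; apply/derivableP; have [] := dK t tt.
  have dP := is_derive1_powR (- (p - 1)) Kt.
  have dKP := @is_derive1_comp R (@powR R ^~ (- (p - 1))) K t _ _ dP dKt.
  have -> : Z = (@powR R ^~ (- (p - 1)) \o K) + (fun t => (p - 1) * c * t) by [].
  apply: is_derive_eq; rewrite scaler1 -mulrA [X in X + _]mulrA.
  by congr (_ * _ `^ _ * _ + _); ring.
have cZ : {within `[0, t0], continuous Z}.
  have -> : Z = (@powR R ^~ (- (p - 1)) \o K) + (fun t => (p - 1) * c * t) by [].
  move=> t; apply: continuousD; last first.
    by apply: continuous_subspaceT => x; apply: mulrl_continuous.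
  move: t; apply/subspace_continuousP => t tt.
  apply: (@continuous_cvg _ _ _ _ _ K).
    apply/differentiable_continuous/derivable1_diffP.
    by apply: derivable_powR; rewrite in_itv/= andbT Kgt0.
  by move/subspace_continuousP : cK; exact.
have decZ : {in `[0, t0] &, {homo Z : x y /~ x <= y}}.
  apply: ler0_derive1_le_cc => //; first by move=> t /dZ[].
  move=> t tt; have /@derive_val := dZ t tt; rewrite -derive1E => ->.
  have Kt : 0 < K t by apply: Kgt0; exact: subset_itv_oo_cc tt.
  rewrite -mulrA mulNr addrC subr_le0 ler_pM2l// powRN mulrC.
  rewrite ler_pdivlMr ?powR_gt0//.
  apply: le_trans (dK_ge t tt).
  have Jt : 0 <= J t by apply: J_ge0; exact: subset_itv_oo_cc tt.
  rewrite (_ : K t = J t * E t)// powRM ?expR_ge0// mulrCA [leRHS]mulrC.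
  rewrite ler_wpM2l ?powR_ge0// /c /E -expRM -expRD ler_expR.
  have tlt : t <= t0 by move: tt; rewrite in_itv/= => /andP[_ /ltW].
  have : (p - 1) * eps * t <= (p - 1) * eps * t0.
    by rewrite ler_wpM2l// mulr_ge0// ltW.
  by rewrite mulrBl !mul1r; lra.
have := decZ _ _ in1 in0 (ltW t00).
rewrite /Z mulr0 addr0 K0 => h.
have {h} : (p - 1) * c * t0 <= J 0 `^ (- (p - 1)).
  by rewrite (le_trans _ h)// lerDr powR_ge0.
rewrite powRN -(ler_pM2r (powR_gt0 (p - 1) J0)) mulVf; last first.
  by rewrite gt_eqF ?powR_gt0.
by rewrite [_ * c * t0]mulrAC.
Qed.

Lemma continuous_bigsum (R : realType) (X : topologicalType) (I : Type)
  (s : seq I) (f : I -> X -> R) :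
  (forall i, continuous (f i)) -> continuous (fun t => \sum_(i <- s) f i t).
Proof.
move=> fc; elim: s => [|i s IH].
  rewrite (_ : (fun _ => _) = cst 0); first exact: cst_continuous.
  by apply/funext => x; rewrite big_nil.
rewrite (_ : (fun _ => _) = f i + (fun t => \sum_(j <- s) f j t)).
  by move=> x; apply: continuousD; [exact: fc|exact: IH].
by apply/funext => x; rewrite big_cons.
Qed.

(** The same [eta] is used twice: as the spectral bound for the test function, and as the distance
    of [u0] from [a] on the set carrying it. Since [t0 < T], the solution is continuous on the
    closed interval [0, t0]. *)
Lemma solution_time_bound (R : realType) (V : choiceType) (G : wgraph R V)
  (p a eta t0 T : R) (u0 : V -> R) (u : V -> R -> R) x0 :
  locally_finite G -> EC G x0 -> 1 < p -> tends_at_infinity G x0 u0 a ->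
  is_solution G p u0 T u -> 0 < t0 < T -> 0 < eta < a ->
  (p - 1) * t0 * expR (- ((p - 1) * eta * t0)) * (a - eta) `^ (p - 1) <= 1.
Proof.
move=> lf ec p1 u0a [u_ge0 u_init u_cont u_deriv _] /andP[t00 t0T] /andP[eta0 etaa].
have [N uN] := u0a _ eta0.
have [A [g [fA farA [g0 gA] [z Az gz] gl]]] := far_test_function N lf ec eta0.
have [S [uS AS NS]] := finite_neighbourhood lf fA.
pose M := \sum_(x <- S) mass G x * g x.
have mg0 x : 0 <= mass G x * g x by rewrite mulr_ge0// ltW// mass_gt0.
have M0 : 0 < M.
  rewrite /M (big_rem z) ?AS//= ltr_pwDl//; first by rewrite mulr_gt0// mass_gt0.
  by apply: sumr_ge0.
pose c x := mass G x * g x / M.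
have c0 x : 0 <= c x by rewrite divr_ge0// ltW.
have c1 : \sum_(x <- S) c x = 1 by rewrite -mulr_suml mulfV// gt_eqF.
pose J t := \sum_(x <- S) c x * u x t.
have in0 t : t \in `]0, t0[ -> t \in `]0, T[.
  by rewrite !in_itv/= => /andP[-> /lt_trans]; exact.
have inc t : t \in `[0, t0] -> 0 <= t < T.
  by rewrite in_itv/= => /andP[-> /le_lt_trans]; exact.
have dJ t : t \in `]0, t0[ -> is_derive t 1 J (\sum_(x <- S) c x * derive1 (u x) t).
  move=> /in0 tt; apply: is_derive1_bigsum => x.
  have [dux _ _] := u_deriv x.
  have dut : is_derive t 1 (u x) (derive1 (u x) t).
    by rewrite derive1E; apply/derivableP/dux.
  exact: (is_deriveZ (c x) dut).
have J0a : a - eta <= J 0.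
  rewrite -[a - eta]mul1r -c1 mulr_suml ler_sum// => x _.
  have [Ax|/gA gx] := pselect (A x); last by rewrite /c gx mulr0 !mul0r.
  rewrite ler_wpM2l// u_init; have := uN x (farA _ Ax).
  by rewrite ltr_norml => /andP[+ _]; lra.
have J0 : 0 < J 0 by rewrite (lt_le_trans _ J0a)// subr_gt0.
apply: (@le_trans _ _
    ((p - 1) * t0 * expR (- ((p - 1) * eta * t0)) * J 0 `^ (p - 1))).
  rewrite ler_wpM2l ?mulr_ge0 ?expR_ge0 ?subr_ge0 ?(ltW p1) ?(ltW t00)//.
  by rewrite ge0_ler_powR// ?nnegrE ?subr_ge0 ?ltW.
apply: blowup_time => //; first exact: ltW.
- apply: continuous_bigsum => x t.
  apply: cvgM; first exact: cvg_cst.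
  apply: continuous_subspaceW (u_cont x) t.
  by move=> s /= /inc; rewrite in_itv.
- by move=> t /dJ[].
- move=> t /inc tt; apply: sumr_ge0 => x _.
  by rewrite mulr_ge0// u_ge0.
- move=> t tt; have /@derive_val := dJ t tt; rewrite -derive1E => ->.
  have tT : 0 <= t < T by apply/inc/(subset_itv_oo_cc tt).
  (* The derivative of the average splits into a diffusion part, bounded below by Green's formula,
     and a reaction part, bounded below by Jensen's inequality. *)
  have -> : \sum_(x <- S) c x * derive1 (u x) t =
      M^-1 * (\sum_(x <- S) mass G x * g x * laplacian G (u ^~ t) x) +
      \sum_(x <- S) c x * u x t `^ p.
    rewrite mulr_sumr -big_split/=; apply: eq_bigr => x _.
    have [_ _ ->] := u_deriv x; last exact: in0.
    by rewrite /c; ring.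
  apply: lerD; last by apply: jensen_powR => // x; exact: u_ge0.
  have -> : - (eta * J t) =
      M^-1 * - (eta * \sum_(x <- S) mass G x * g x * u x t).
    rewrite mulrN mulrCA; congr (- (_ * _)); rewrite mulr_sumr.
    by apply: eq_bigr => x _; rewrite /c; ring.
  rewrite ler_wpM2l ?invr_ge0 ?(ltW M0)//.
  by apply: (green_test uS NS AS g0 gA gl) => x; exact: u_ge0.
Qed.

(** Lets [eta] tend to 0 from the right at fixed [t0 < T], by continuity of the bound at
    [eta = 0]. *)
Lemma solution_life_le (R : realType) (V : choiceType) (G : wgraph R V)
  (p a T : R) (u0 : V -> R) (u : V -> R -> R) x0 :
  locally_finite G -> EC G x0 -> 1 < p -> tends_at_infinity G x0 u0 a ->
  0 < a -> 0 < T -> is_solution G p u0 T u ->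
  T <= ((p - 1) * a `^ (p - 1))^-1.
Proof.
move=> lf ec p1 u0a a0 T0 su.
have q0 : 0 < p - 1 by rewrite subr_gt0.
have qa0 : 0 < (p - 1) * a `^ (p - 1) by rewrite mulr_gt0// powR_gt0.
suff h t0 : 0 < t0 < T -> (p - 1) * t0 * a `^ (p - 1) <= 1.
  rewrite leNgt; apply/negP => lT.
  (* Were [T] beyond the bound, the midpoint [t0] would lie strictly between the two and contradict
     [h]. *)
  have [] := (midf_lt lT); set t0 := (_ / _) => h1 h2.
  have t00 : 0 < t0 by rewrite (lt_trans _ h1)// invr_gt0.
  have := h t0; rewrite t00 h2 => /(_ erefl).
  rewrite mulrAC -ler_pdivlMl// mulr1 leNgt.
  by rewrite h1.
move=> t0T.
pose F eta := (p - 1) * t0 * expR (- ((p - 1) * eta * t0)) * (a - eta) `^ (p - 1).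
have cF : {for 0, continuous F}.
  apply: continuousM.
    apply: continuousM; first exact: cst_continuous.
    apply: continuous_comp; last exact: continuous_expR.
    apply: continuousN; apply: continuousM; last exact: cst_continuous.
    apply: continuousM; [exact: cst_continuous|exact: cvg_id].
  apply: (@continuous_comp _ _ _ (fun eta => a - eta) (@powR R ^~ (p - 1))).
    apply: continuousB; [exact: cst_continuous|exact: cvg_id].
  apply/differentiable_continuous/derivable1_diffP.
  by apply: derivable_powR; rewrite in_itv/= andbT subr0.
have F0 : F 0 = (p - 1) * t0 * a `^ (p - 1).
  by rewrite /F mulr0 mul0r oppr0 expR0 mulr1 addr0.
rewrite -F0.
have cF' : F x @[x --> 0^'+] --> F 0 by apply: cvg_at_right_filter.
apply: (cvgr_to_le cF'); near=> eta.
apply: (solution_time_bound lf ec p1 u0a su t0T).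
by apply/andP; split; near: eta; [exact: nbhs_right_gt|exact: nbhs_right_lt].
Unshelve. all: by end_near. Qed.

(** * Existence by monotone iteration *)

(* [powR] jumps at 0 from the left ([x `^ p = 1] for [x < 0]), hence the sign
   condition. *)
Lemma cvg_powR (R : realType) (T : Type) (F : set_system T) {FF : Filter F}
  (f : T -> R) (l p : R) : 0 < p -> (forall t, 0 <= f t) -> 0 <= l ->
  f @ F --> l -> (f t `^ p) @[t --> F] --> l `^ p.
Proof.
move=> p0 f0; rewrite le_eqVlt => /predU1P[<- fl|l0 fl]; last first.
  apply: (@continuous_cvg _ _ _ F _ f (@powR R ^~ p)) => //.
  apply/differentiable_continuous/derivable1_diffP.
  by apply: derivable_powR; rewrite in_itv/= andbT.
rewrite powR0 ?gt_eqF//; apply/cvgr0Pnorm_lt => e e0.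
have e'0 : 0 < e `^ p^-1 by rewrite powR_gt0.
move/cvgr0Pnorm_lt : fl => /(_ _ e'0); apply: filterS => t.
rewrite ger0_norm// => ft; rewrite ger0_norm ?powR_ge0//.
rewrite (_ : e = (e `^ p^-1) `^ p); last first.
  by rewrite -powRrM mulVf ?gt_eqF// powRr1// ltW.
by rewrite gt0_ltr_powR// ?nnegrE ?powR_ge0 ?f0.
Qed.

(** [g - f] has a nonnegative derivative. The derivatives are two-sided at 0 and [b] as well, so
    functions compared this way must be defined beyond [0, b]. *)
Lemma derive_le (R : realType) (f g df dg : R -> R) (b : R) :
  (forall t, 0 <= t <= b -> is_derive t 1 f (df t)) ->
  (forall t, 0 <= t <= b -> is_derive t 1 g (dg t)) ->
  (forall t, 0 <= t <= b -> df t <= dg t) ->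
  f 0 <= g 0 -> forall t, 0 <= t <= b -> f t <= g t.
Proof.
move=> fd gd fg fg0 t /[dup] tb /andP[t0 tlb].
have hd s : s \in `[0, b] -> is_derive s 1 (g - f) (dg s - df s).
  rewrite in_itv/= => sb; have := fd s sb; have := gd s sb => ? ?.
  exact: is_deriveB.
have : (g - f) 0 <= (g - f) t.
  apply: (@ger0_derive1_le_cc R (g - f) 0 b) => //.
  - by move=> s /subset_itv_oo_cc/hd[].
  - move=> s /subset_itv_oo_cc sb; have /@derive_val := hd s sb.
    by rewrite -derive1E => ->; rewrite subr_ge0 fg// -in_itv.
  - by apply: derivable_within_continuous => s /hd[].
  - by rewrite in_itv/= lexx (le_trans t0).
rewrite [X in X <= _ -> _](_ : _ = g 0 - f 0)// [X in _ <= X -> _](_ : _ = g t - f t)//.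
by lra.
Qed.

(* The base point [-1] makes [prim h] differentiable at [0]. *)
Definition prim (R : realType) (h : R -> R) (t : R) : R :=
  \int[lebesgue_measure]_(s in `[-1, t]) h s -
  \int[lebesgue_measure]_(s in `[-1, 0]) h s.

Lemma prim0 (R : realType) (h : R -> R) : prim h 0 = 0.
Proof. exact: subrr. Qed.

Lemma continuous_integrable_itv (R : realType) (h : R -> R) (a b : R) :
  continuous h -> lebesgue_measure.-integrable `[a, b] (EFin \o h).
Proof.
move=> ch; apply: continuous_compact_integrable; first exact: segment_compact.
exact: continuous_subspaceT.
Qed.

Lemma is_derive_prim (R : realType) (h : R -> R) (t : R) :
  continuous h -> 0 <= t -> is_derive t 1 (prim h) (h t).
Proof.
move=> ch t0; have t1 : -1 < t by rewrite (lt_le_trans _ t0)// ltrN10.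
(* The endpoint [t + 1] makes [t] interior to the interval of integration. *)
have tt1 : t < t + 1 by rewrite ltrDl.
have [dF F'] := continuous_FTC1_closed tt1
  (continuous_integrable_itv (-1) (t + 1) ch) t1 (ch t).
have dP : is_derive t 1 (fun x => \int[lebesgue_measure]_(s in `[-1, x]) h s) (h t).
  by rewrite -F' derive1E; apply/derivableP.
rewrite /prim -[h t]subr0; exact: is_deriveB.
Qed.

(** Dominated convergence, the constant [C] being integrable on a bounded interval. *)
Lemma cvg_Rintegral_bounded (R : realType) (h_ : nat -> R -> R) (h : R -> R)
  (a b C : R) :
  (forall n, continuous (h_ n)) -> continuous h ->
  (forall s, h_ ^~ s @ \oo --> h s) -> (forall n s, `|h_ n s| <= C) ->
  (\int[lebesgue_measure]_(s in `[a, b]) h_ n s) @[n --> \oo] -->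
  \int[lebesgue_measure]_(s in `[a, b]) h s.
Proof.
move=> ch_ ch hh hC.
have mh (f : R -> R) : continuous f -> measurable_fun `[a, b] f.
  by move=> cf; apply: measurable_funS (continuous_measurable_fun cf).
have hh' s : (h_ n s)%:E @[n --> \oo] --> (h s)%:E.
  by apply: cvg_EFin; [exact: nearW|exact: hh].
have [|||ih _ hcvg] := @dominated_convergence _ _ R lebesgue_measure `[a, b]
  (measurable_itv _) (fun n s => (h_ n s)%:E) (fun s => (h s)%:E) (fun=> C%:E)
  (fun n => (measurable_EFinP _ _).2 (mh _ (ch_ n)))
  ((measurable_EFinP _ _).2 (mh _ ch)) _ _ _.
- by apply: aeW => s _; exact: hh'.
- by apply: continuous_integrable_itv; exact: cst_continuous.
- by apply: aeW => s n _; exact: hC.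
apply: fine_cvg; rewrite fineK//.
exact: integrable_fin_num ih.
Qed.

Lemma cvg_prim (R : realType) (h_ : nat -> R -> R) (h : R -> R) (C t : R) :
  (forall n, continuous (h_ n)) -> continuous h ->
  (forall s, h_ ^~ s @ \oo --> h s) -> (forall n s, `|h_ n s| <= C) ->
  prim (h_ n) t @[n --> \oo] --> prim h t.
Proof.
move=> ch_ ch hh hC; apply: cvgB; exact: cvg_Rintegral_bounded hC.
Qed.

(** Projection of the line onto [0, b]. Composition with it extends a function on [0, b] to the
    whole line, keeping continuity and bounds, as required to apply [prim]. *)
Definition clip (R : realType) (b t : R) : R := Num.max 0 (Num.min t b).

Lemma clip_itv (R : realType) (b t : R) : 0 <= b -> 0 <= clip b t <= b.
Proof. by move=> b0; rewrite /clip le_max lexx ge_max b0 ge_min lexx orbT. Qed.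

Lemma clip_id (R : realType) (b t : R) : 0 <= t <= b -> clip b t = t.
Proof. by move=> /andP[t0 tb]; rewrite /clip min_l// max_r. Qed.

Lemma continuous_clip (R : realType) (b : R) : continuous (clip b).
Proof.
move=> t; apply: (@continuous_max _ _ (cst 0) (fun t => Num.min t b)).
  exact: cst_continuous.
apply: (@continuous_min _ _ id (cst b)); first exact: cvg_id.
exact: cst_continuous.
Qed.

(* In the unknown [v = expR (D * t) * u] the equation becomes [v' = rhs v], and
   [rhs] is monotone because the negative diagonal part of the Laplacian has been
   absorbed by [D]. *)
Section MonotoneIteration.
Context {R : realType} {V : choiceType} (S : V -> seq V) (c : V -> V -> R).
Context (D p b M : R) (u0 : V -> R).
Context (c_ge0 : forall x y, 0 <= c x y).
Context (c_sum : forall x, \sum_(y <- S x) c x y = D).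
Context (D_ge0 : 0 <= D) (p_gt1 : 1 < p) (b_gt0 : 0 < b) (M_gt0 : 0 < M).
Context (b_lt : (p - 1) * b < M `^ (- (p - 1))).
Context (u0_itv : forall x, 0 <= u0 x <= M).

Definition rhs (f : V -> R -> R) (x : V) (s : R) : R :=
  \sum_(y <- S x) c x y * f y s + expR (- ((p - 1) * D * s)) * f x s `^ p.

(* [ode_flow] solves [m' = m `^ p], [m 0 = M]. *)
Definition ode_flow (t : R) : R :=
  (M `^ (- (p - 1)) - (p - 1) * t) `^ (- (p - 1)^-1).

Definition barrier (t : R) : R := expR (D * t) * ode_flow t.

Let q_gt0 : 0 < p - 1. Proof. by rewrite subr_gt0. Qed.

Let p_gt0 : 0 < p. Proof. exact: lt_trans p_gt1. Qed.

Lemma ode_flow_base t : 0 <= t <= b -> 0 < M `^ (- (p - 1)) - (p - 1) * t.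
Proof.
move=> /andP[_ tb]; rewrite subr_gt0 (le_lt_trans _ b_lt)//.
by rewrite ler_wpM2l// ltW.
Qed.

Lemma ode_flow0 : ode_flow 0 = M.
Proof.
rewrite /ode_flow mulr0 subr0 -powRrM mulrNN mulfV ?gt_eqF// powRr1//.
exact: ltW.
Qed.

Lemma ode_flow_le t : 0 <= t <= b -> ode_flow t <= ode_flow b.
Proof.
move=> tb; have bb : 0 <= b <= b by rewrite lexx ltW.
have b1 := ode_flow_base bb.
rewrite /ode_flow !(powRN _ (p - 1)^-1) lef_pV2 ?posrE ?powR_gt0 ?ode_flow_base//.
rewrite ge0_ler_powR ?nnegrE ?invr_ge0 ?(ltW b1) ?(ltW (ode_flow_base tb)) ?(ltW q_gt0)//.
by rewrite lerB// ler_wpM2l ?(ltW q_gt0)//; case/andP: tb.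
Qed.

Lemma is_derive_ode_flow t : 0 <= t <= b ->
  is_derive t 1 ode_flow (ode_flow t `^ p).
Proof.
move=> tb; pose g (t : R) := M `^ (- (p - 1)) - (p - 1) * t.
have dg : is_derive t 1 g (- (p - 1)).
  rewrite /g; apply: is_derive_eq; rewrite /GRing.scale/=; ring.
have dP := is_derive1_powR (- (p - 1)^-1) (ode_flow_base tb).
have := @is_derive1_comp R (@powR R ^~ (- (p - 1)^-1)) g t _ _ dP dg.
rewrite (_ : _ \o _ = ode_flow)// => h; apply: (is_derive_eq h).
rewrite /ode_flow -powRrM -mulrA [X in _ * X]mulrC mulrA.
rewrite mulrNN mulVf ?gt_eqF// mul1r; congr (_ `^ _); field.
by rewrite gt_eqF.
Qed.

(** The row sums [D] turn the linear term of a spatially constant function into [D * barrier], so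
    the barrier solves [v' = rhs v] exactly. *)
Lemma is_derive_barrier x t : 0 <= t <= b ->
  is_derive t 1 barrier (rhs (fun=> barrier) x t).
Proof.
move=> tb; have dm := is_derive_ode_flow tb.
have dE : is_derive t 1 (fun t : R => expR (D * t)) (D * expR (D * t)).
  by apply: is_derive_eq; rewrite scaler1 mulrC.
rewrite (_ : barrier = (fun t : R => expR (D * t)) * ode_flow)//.
apply: is_derive_eq; rewrite /rhs -mulr_suml c_sum /GRing.scale/=.
rewrite (_ : ((_ * _) t) = barrier t)// /barrier.
rewrite powRM ?expR_ge0 ?powR_ge0// [X in _ = _ + X]mulrA -expRM -expRD.
rewrite (_ : - _ + _ = D * t); last by ring.
ring.
Qed.

Definition barrier_max : R := expR (D * b) * ode_flow b.

Lemma barrier_ge0 t : 0 <= barrier t.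
Proof. by rewrite mulr_ge0 ?expR_ge0 ?powR_ge0. Qed.

Lemma barrier_le t : 0 <= t <= b -> barrier t <= barrier_max.
Proof.
move=> tb; rewrite ler_pM ?expR_ge0 ?powR_ge0 ?ode_flow_le// ler_expR.
by rewrite ler_wpM2l//; case/andP: tb.
Qed.

(** Continuity is asked of the clipped function, hence on the whole line; values outside [0, b] stay
    free. *)
Definition admissible (f : V -> R -> R) : Prop :=
  (forall x t, 0 <= t <= b -> 0 <= f x t <= barrier t) /\
  (forall x, continuous (f x \o clip b)).

(** The Picard map of [v' = rhs v], [v 0 = u0]. *)
Definition step (f : V -> R -> R) (x : V) (t : R) : R :=
  u0 x + prim (rhs f x \o clip b) t.

Lemma rhs_le f g x t : 0 <= t <= b -> (forall y, 0 <= f y t <= g y t) ->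
  0 <= rhs f x t <= rhs g x t.
Proof.
move=> tb fg; have f0 y : 0 <= f y t by case/andP: (fg y).
have fg' y : f y t <= g y t by case/andP: (fg y).
apply/andP; split.
  rewrite addr_ge0 ?mulr_ge0 ?expR_ge0 ?powR_ge0//.
  by apply: sumr_ge0 => y _; rewrite mulr_ge0.
apply: lerD; first by apply: ler_sum => y _; rewrite ler_wpM2l.
rewrite ler_wpM2l ?expR_ge0// ge0_ler_powR ?nnegrE ?(ltW p_gt0)//.
exact: le_trans (fg' x).
Qed.

(** Comparison with the constant function [barrier_max]. The bound is uniform in [f], [x] and [t]:
    it serves both as a Lipschitz constant in time and as the dominating constant under the
    integral. *)
Lemma rhs_max f x t : admissible f -> 0 <= t <= b ->
  0 <= rhs f x t <= D * barrier_max + barrier_max `^ p.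
Proof.
move=> [fB _] tb; have [|f0 fb] := andP (@rhs_le f (fun _ _ => barrier_max) x t tb _).
  by move=> y; have /andP[-> /le_trans->//] := fB y t tb; exact: barrier_le.
rewrite f0 (le_trans fb)// /rhs -mulr_suml c_sum lerD2l.
rewrite -[leRHS]mul1r ler_wpM2r ?powR_ge0// -expR0 ler_expR oppr_le0.
by have /andP[t0 _] := tb; rewrite !mulr_ge0// expR0 ltW.
Qed.

Lemma continuous_rhs f x : admissible f -> continuous (rhs f x \o clip b).
Proof.
move=> [fB fc] s; apply: cvgD.
  have : continuous (fun s => \sum_(y <- S x) c x y * f y (clip b s)).
    apply: continuous_bigsum => y r; apply: cvgM; first exact: cvg_cst.
    exact: fc.
  exact.
apply: cvgM.
  apply: (continuous_cvg _ (@continuous_expR R _)).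
  apply: cvgN; apply: cvgM; first exact: cvg_cst.
  exact: continuous_clip.
apply: cvg_powR => //; last exact: fc.
  by move=> r; have /andP[] := fB x _ (clip_itv r (ltW b_gt0)).
by have /andP[] := fB x _ (clip_itv s (ltW b_gt0)).
Qed.

Lemma is_derive_step f x t : admissible f -> 0 <= t <= b ->
  is_derive t 1 (step f x) (rhs f x t).
Proof.
move=> fa tb; have t0 : 0 <= t by case/andP: tb.
have := is_derive_prim (continuous_rhs (x := x) fa) t0; rewrite /= clip_id// => h.
rewrite (_ : step f x = cst (u0 x) + prim (rhs f x \o clip b))//.
by apply: is_derive_eq; rewrite add0r.
Qed.

Lemma step0 f x : step f x 0 = u0 x.
Proof. by rewrite /step prim0 addr0. Qed.

Lemma continuous_step f x : admissible f -> continuous (step f x \o clip b).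
Proof.
move=> fa s; apply: continuous_comp; first exact: continuous_clip.
apply/differentiable_continuous/derivable1_diffP.
by have [] := is_derive_step x fa (clip_itv s (ltW b_gt0)).
Qed.

Lemma step_le f g : admissible f -> admissible g ->
  (forall x t, 0 <= t <= b -> f x t <= g x t) ->
  forall x t, 0 <= t <= b -> step f x t <= step g x t.
Proof.
move=> fa ga fg x; apply: derive_le.
- by move=> t; exact: is_derive_step.
- by move=> t; exact: is_derive_step.
- move=> t tb; have [|//] := andP (@rhs_le f g x t tb _).
  by move=> y; rewrite fg// andbT; have /andP[] := fa.1 y t tb.
- by rewrite !step0.
Qed.

(** Derivatives are compared: [0 <= rhs f <= rhs barrier], the last being the derivative of the
    barrier, which starts at [M >= u0 x]. *)
Lemma admissible_step f : admissible f -> admissible (step f).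
Proof.
move=> fa; split; last by move=> x; exact: continuous_step.
move=> x t tb; have /andP[u00 u0M] := u0_itv x; apply/andP; split.
  apply: (@derive_le R (cst 0) (step f x) (cst 0) (rhs f x) b) => //.
  - by move=> s; exact: is_derive_step.
  - by move=> s /(rhs_max x fa)/andP[].
  - by rewrite step0.
apply: (@derive_le R (step f x) barrier (rhs f x) (rhs (fun=> barrier) x) b) => //.
- by move=> s; exact: is_derive_step.
- by move=> s; exact: is_derive_barrier.
- move=> s sb; have [|//] := andP (@rhs_le f (fun=> barrier) x s sb _).
  by move=> y; exact: fa.1.
- by rewrite step0 /barrier mulr0 expR0 mul1r ode_flow0.
Qed.

(** The constant does not depend on [f], so the estimate survives pointwise limits and makes the
    limit of the iterates continuous. *)
Lemma step_lipschitz f x s t : admissible f -> 0 <= s <= b -> 0 <= t <= b ->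
  `|step f x s - step f x t| <= (D * barrier_max + barrier_max `^ p) * `|s - t|.
Proof.
move=> fa; wlog st : s t / s <= t => [hw sb tb|sb tb].
  have [/hw|/ltW/hw] := leP s t; first exact.
  by rewrite distrC [`|t - s|]distrC; apply.
have inb r : r \in `[s, t] -> 0 <= r <= b.
  rewrite in_itv/= => /andP[sr rt]; move: sb tb => /andP[s0 _] /andP[_ tb'].
  by rewrite (le_trans s0 sr) (le_trans rt).
have [||r rst] := @MVT_segment R (step f x) (rhs f x) s t st.
- by move=> r /subset_itv_oo_cc/inb; exact: is_derive_step.
- apply: derivable_within_continuous => r /inb rb.
  by have [] := is_derive_step x fa rb.
rewrite distrC => ->; rewrite normrM [`|t - s|]distrC ler_wpM2r//.
by have /andP[r0 rM] := rhs_max x fa (inb _ rst); rewrite ger0_norm.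
Qed.

Definition iterate (n : nat) : V -> R -> R := iter n step (fun _ _ => 0).

Lemma admissible_iterate n : admissible (iterate n).
Proof.
elim: n => [|n IH]; last exact: admissible_step.
split=> [x t tb|x]; first by rewrite lexx barrier_ge0.
exact: cst_continuous.
Qed.

Lemma iterate_nondecreasing x t : 0 <= t <= b ->
  nondecreasing_seq (fun n => iterate n x t).
Proof.
move=> tb; apply/nondecreasing_seqP => n; elim: n x t tb => [|n IH] x t tb.
  by have /andP[] := (admissible_iterate 1).1 x t tb.
apply: (step_le (admissible_iterate n) (admissible_iterate n.+1)) => //.
Qed.

Definition iterate_lim (x : V) (t : R) : R := limn (fun n => iterate n x t).

Lemma cvg_iterate x t : 0 <= t <= b ->
  iterate n x t @[n --> \oo] --> iterate_lim x t.
Proof.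
move=> tb; apply: nondecreasing_is_cvgn; first exact: iterate_nondecreasing.
exists (barrier t) => _ [n _ <-].
by have /andP[] := (admissible_iterate n).1 x t tb.
Qed.

Lemma admissible_iterate_lim : admissible iterate_lim.
Proof.
split=> [x t tb|x s].
  apply/andP; split.
    apply: (cvgr_to_ge (cvg_iterate (x := x) tb)); apply: nearW => n.
    by have /andP[] := (admissible_iterate n).1 x t tb.
  apply: (cvgr_to_le (cvg_iterate (x := x) tb)); apply: nearW => n.
  by have /andP[] := (admissible_iterate n).1 x t tb.
have lip r : `|iterate_lim x (clip b s) - iterate_lim x (clip b r)| <=
    (D * barrier_max + barrier_max `^ p) * `|clip b s - clip b r|.
  have sb := clip_itv s (ltW b_gt0); have rb := clip_itv r (ltW b_gt0).
  have h : `|iterate n x (clip b s) - iterate n x (clip b r)| @[n --> \oo] -->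
      `|iterate_lim x (clip b s) - iterate_lim x (clip b r)|.
    by apply: cvg_norm; apply: cvgB; exact: cvg_iterate.
  (* The zeroth iterate is the zero function, not an image of [step], and is treated apart. *)
  apply: (cvgr_to_le h); apply: nearW => -[|n] /=.
    rewrite subrr normr0 mulr_ge0// addr_ge0 ?powR_ge0// mulr_ge0//.
    by rewrite mulr_ge0 ?expR_ge0 ?powR_ge0.
  by apply: step_lipschitz => //; exact: admissible_iterate.
have K0 : 0 <= D * barrier_max + barrier_max `^ p.
  by rewrite addr_ge0 ?powR_ge0// !mulr_ge0 ?expR_ge0 ?powR_ge0.
apply/cvgrPdist_le => /= e e0.
(* The Lipschitz constant is only known to be nonnegative; adding 1 makes the division
   legitimate. *)
have e'0 : 0 < e / (D * barrier_max + barrier_max `^ p + 1).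
  by rewrite divr_gt0// ltr_wpDl.
have /cvgrPdist_le/(_ _ e'0) := @continuous_clip R b s.
apply: filterS => r; rewrite ler_pdivlMr ?ltr_wpDl// => er.
rewrite (le_trans (lip r))// (le_trans _ er)// mulrC ler_wpM2l//.
by rewrite lerDl.
Qed.

(** The shifted iterates converge to [iterate_lim] and, by dominated convergence, also to its image
    under [step]. *)
Lemma step_iterate_lim x t : 0 <= t <= b ->
  step iterate_lim x t = iterate_lim x t.
Proof.
move=> tb.
have cvgS : iterate n.+1 x t @[n --> \oo] --> iterate_lim x t.
  by have := cvg_iterate (x := x) tb; rewrite -(cvg_shiftS (fun n => iterate n x t)).
apply: cvg_unique cvgS; first exact: Rhausdorff.
apply: cvgD; first exact: cvg_cst.
apply: (@cvg_prim _ _ _ (D * barrier_max + barrier_max `^ p)).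
- by move=> n; apply: continuous_rhs; exact: admissible_iterate.
- by apply: continuous_rhs; exact: admissible_iterate_lim.
- move=> s /=; have sb := clip_itv s (ltW b_gt0).
  apply: cvgD.
    apply: cvg_big => [|y _]; first exact: add_continuous.
    by apply: cvgM; [exact: cvg_cst|exact: cvg_iterate].
  apply: cvgM; first exact: cvg_cst.
  apply: cvg_powR => //.
  + by move=> n; have /andP[] := (admissible_iterate n).1 x _ sb.
  + by have /andP[] := admissible_iterate_lim.1 x _ sb.
  + exact: cvg_iterate.
- move=> n s; have sb := clip_itv s (ltW b_gt0).
  have /andP[r0 rM] := rhs_max x (admissible_iterate n) sb.
  by rewrite ger0_norm.
Qed.

Lemma monotone_iteration : exists v : V -> R -> R,
  [/\ forall x t, 0 <= t <= b -> 0 <= v x t <= barrier t,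
      forall x, v x 0 = u0 x,
      forall x t, 0 <= t <= b -> is_derive t 1 (v x) (rhs v x t)
    & forall x, continuous (rhs v x \o clip b)].
Proof.
have la := admissible_iterate_lim; have sa := admissible_step la.
(* [step iterate_lim] is chosen over [iterate_lim], with which it agrees on [0, b], because
   [is_derive_step] gives it two-sided derivatives even at the endpoints. *)
exists (step iterate_lim); split.
- exact: sa.1.
- by move=> x; rewrite step0.
- move=> x t tb; have -> : rhs (step iterate_lim) x t = rhs iterate_lim x t.
    rewrite /rhs step_iterate_lim//; congr (_ + _).
    by apply: eq_bigr => y _; rewrite step_iterate_lim.
  exact: is_derive_step.
- by move=> x; exact: continuous_rhs.
Qed.

End MonotoneIteration.

(** * Existence of solutions on the graph *)

Lemma degree_bound (R : realType) (V : choiceType) (G : wgraph R V) :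
  (D_mu G < +oo)%E -> exists2 D : R, 0 <= D &
  forall x, (mass G x)^-1 * \sum_(y \in neighbours G x) weight G x y <= D.
Proof.
move=> Dfin; exists (Num.max 0 (fine (D_mu G))) => [|x].
  by rewrite le_max lexx.
have : (((mass G x)^-1 * \sum_(y \in neighbours G x) weight G x y)%:E
   <= D_mu G)%E by apply: ereal_sup_ubound; exists x.
by case: (D_mu G) Dfin => // r _; rewrite lee_fin le_max => ->; rewrite orbT.
Qed.

(** The diagonal entry is [D] minus the weighted degree, nonnegative by the degree bound. As there
    are no loops, [x] can be put in front of its list of neighbours without a clash. *)
Lemma laplacian_shift (R : realType) (V : choiceType) (G : wgraph R V) (D : R) :
  locally_finite G ->
  (forall x, (mass G x)^-1 * \sum_(y \in neighbours G x) weight G x y <= D) ->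
  exists (S : V -> seq V) (c : V -> V -> R),
    [/\ forall x y, 0 <= c x y, forall x, \sum_(y <- S x) c x y = D
      & forall f x, \sum_(y <- S x) c x y * f y = laplacian G f x + D * f x].
Proof.
move=> lf dD.
pose N x : seq V := finmap.enum_fset (fset_set (neighbours G x)).
have uN x : uniq (N x) by exact: finmap.fset_uniq.
have NE x y : (y \in N x) = edge G x y.
  by rewrite in_fset_set; [apply/idP/idP; rewrite inE|exact: lf].
have xN x : x \notin N x by rewrite NE edge_irrefl.
pose dg x := (mass G x)^-1 * \sum_(y <- N x) weight G x y.
have dgD x : dg x <= D.
  have := dD x; under eq_fsbigr do rewrite -[weight _ _ _]mulr1.
  rewrite (sum_neighbours (fun=> 1) (uN x)) => [|y]; last by rewrite NE.
  by under eq_bigr do rewrite mulr1.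
pose c x y := if y == x then D - dg x else weight G x y / mass G x.
have cN (F : V -> R) x : \sum_(y <- N x) c x y * F y =
    (mass G x)^-1 * \sum_(y <- N x) weight G x y * F y.
  rewrite mulr_sumr big_seq_cond [RHS]big_seq_cond; apply: eq_bigr => y.
  rewrite andbT => yN; rewrite /c ifF; first by rewrite mulrAC mulrC.
  by move: (xN x); apply: contraNF => /eqP yx; rewrite -{1}yx.
exists (fun x => x :: N x), c.
have cf f x : \sum_(y <- x :: N x) c x y * f y = laplacian G f x + D * f x.
  rewrite big_cons cN {1}/c eqxx.
  have m0 : mass G x != 0 by rewrite gt_eqF// mass_gt0.
  apply: (mulfI m0); rewrite mulrDr [in RHS]mulrDr.
  rewrite (laplacian_seq _ (uN x)) => [|y]; last by rewrite NE.
  rewrite mulVKf//.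
  under [in RHS]eq_bigr do rewrite mulrBr.
  rewrite sumrB -mulr_suml /dg; field.
  by [].
split => //.
- move=> x y; rewrite /c; case: ifPn => _; first by rewrite subr_ge0.
  by rewrite divr_ge0// ?weight_ge0// ltW// mass_gt0.
(* The row sum is the identity applied to the constant 1, which the Laplacian annihilates. *)
- move=> x; have := cf (fun=> 1) x; under eq_bigr do rewrite mulr1.
  move=> ->; rewrite mulr1 /laplacian; under eq_fsbigr do rewrite subrr mulr0.
  by rewrite fsbig1// mulr0 add0r.
Qed.

(** Undoes the substitution: [u = expR (- D * t) * v]. *)
Lemma solution_exists (R : realType) (V : choiceType) (G : wgraph R V)
  (p b M : R) (u0 : V -> R) :
  locally_finite G -> (D_mu G < +oo)%E -> 1 < p -> 0 < b -> 0 < M ->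
  (p - 1) * b < M `^ (- (p - 1)) -> (forall x, 0 <= u0 x <= M) ->
  exists u, is_solution G p u0 b u.
Proof.
move=> lf /degree_bound[D D0 dD] p1 b0 M0 bM u0M.
have [S [c [c0 cS cL]]] := laplacian_shift lf dD.
have [v [vB v0 dv cv]] := monotone_iteration c0 cS D0 p1 b0 M0 bM u0M.
pose E t := expR (- D * t).
have dE (t : R) : is_derive t 1 E (- D * E t).
  by rewrite /E; apply: is_derive_eq; rewrite scaler1 mulrC.
have cE : continuous E.
  by move=> t; apply/differentiable_continuous/derivable1_diffP; apply: ex_derive.
pose u x t := E t * v x t.
(* The derivative of [u x] on [0, b]; clipping the time in [rhs] makes it continuous at the points
   of ]0, b[, where it agrees locally with [derive1 (u x)]. *)
pose du x t := - D * u x t + E t * rhs S c D p v x (clip b t).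
have du_der x t : 0 <= t <= b -> is_derive t 1 (u x) (du x t).
  move=> tb; have dvt := dv x t tb.
  rewrite (_ : u x = E * v x)//; apply: is_derive_eq.
  by rewrite /du /u clip_id// /GRing.scale/=; ring.
have inb t : t \in `]0, b[ -> 0 <= t <= b.
  by rewrite in_itv/= => /andP[t0 tb]; rewrite !ltW.
have duE x t : 0 <= t <= b -> derive1 (u x) t = du x t.
  by move=> tb; rewrite derive1E; have [] := du_der x t tb.
have u_ge0 x t : 0 <= t <= b -> 0 <= u x t.
  by move=> tb; rewrite mulr_ge0 ?expR_ge0//; have /andP[] := vB x t tb.
exists u; split.
- by move=> x t /andP[t0 tb]; rewrite u_ge0// t0 ltW.
- by move=> x; rewrite /u /E mulr0 expR0 mul1r.
- move=> x; apply: derivable_within_continuous => t; rewrite in_itv/= => /andP[t0 tb].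
  by have [] := du_der x t; first by rewrite t0 ltW.
- move=> x; split.
  + by move=> t /inb tb; have [] := du_der x t tb.
  + move=> t tt; have tb := inb t tt.
    have cdu : {for t, continuous (du x)}.
      apply: cvgD.
        apply: cvgM; first exact: cvg_cst.
        apply/differentiable_continuous/derivable1_diffP.
        by have [] := du_der x t tb.
      by apply: cvgM; [exact: cE|exact: cv].
    rewrite /continuous_at duE//; apply: cvg_trans cdu; apply: near_eq_cvg.
    near=> s; rewrite duE//; apply: inb; near: s.
    exact: near_in_itvoo.
  + move=> t /inb tb; rewrite duE// /du clip_id// /rhs cL.
    rewrite (_ : laplacian G (u ^~ t) x = E t * laplacian G (v ^~ t) x).
      rewrite /u powRM ?expR_ge0//; last by have /andP[] := vB x t tb.
      rewrite mulrDr [X in _ + (_ + X)]mulrA -expRM -expRD.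
      rewrite (_ : - D * t + _ = - D * t * p); last by ring.
      by ring.
    (* With [D * u x t] added, both sides become finite sums over [S x] through [cL], where the
       factor [E t] comes out. *)
    apply: (addIr (D * u x t)); rewrite -cL.
    rewrite (_ : E t * _ + _ = E t * (laplacian G (v ^~ t) x + D * v x t)).
      by rewrite -cL mulr_sumr; apply: eq_bigr => y _; rewrite /u; ring.
    by rewrite /u; ring.
- move=> T' /andP[T'0 T'b]; exists (barrier_max D p b M) => x t /andP[t0 tT'].
  have tb : 0 <= t <= b by rewrite t0 (le_trans tT')// ltW.
  have /andP[v_ge0 vle] := vB x t tb.
  apply: (@le_trans _ _ (v x t)); last first.
    by apply: le_trans vle _; exact: barrier_le.
  rewrite /u -[leRHS]mul1r ler_wpM2r// -expR0 ler_expR.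
  by rewrite mulNr oppr_le0 mulr_ge0.
Unshelve. all: by end_near. Qed.

(** * Bounds on the life span, and lower and upper limits *)

(** Existence needs a time strictly below the critical one; every fraction [r < 1] of it qualifies,
    and the supremum reaches the critical time itself. *)
Lemma life_span_ge (R : realType) (V : choiceType) (G : wgraph R V)
  (p M : R) (u0 : V -> R) :
  locally_finite G -> (D_mu G < +oo)%E -> 1 < p -> 0 < M ->
  (forall x, 0 <= u0 x <= M) ->
  ((((p - 1) * M `^ (p - 1))^-1)%:E <= life_span G p u0)%E.
Proof.
move=> lf Dfin p1 M0 u0M.
have q0 : 0 < p - 1 by rewrite subr_gt0.
have C0 : 0 < ((p - 1) * M `^ (p - 1))^-1 by rewrite invr_gt0 mulr_gt0// powR_gt0.
apply/lee_mul01Pr; first by rewrite lee_fin ltW.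
move=> r /andP[r0 r1]; apply: ereal_sup_ubound.
exists (r * ((p - 1) * M `^ (p - 1))^-1) => //; split; first by rewrite mulr_gt0.
apply: (solution_exists (M := M)) => //; first by rewrite mulr_gt0.
rewrite powRN invfM mulrCA mulVKf ?gt_eqF//.
by rewrite gtr_pMl// invr_gt0 powR_gt0.
Qed.

Lemma life_span_le (R : realType) (V : choiceType) (G : wgraph R V)
  (p a : R) (u0 : V -> R) x0 :
  locally_finite G -> EC G x0 -> 1 < p -> tends_at_infinity G x0 u0 a ->
  0 < a -> (life_span G p u0 <= (((p - 1) * a `^ (p - 1))^-1)%:E)%E.
Proof.
move=> lf ec p1 u0a a0; apply: ge_ereal_sup => _ [T [T0 [u su]] <-].
by rewrite lee_fin (solution_life_le lf ec p1 u0a a0 T0 su).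
Qed.

(** Two members of a proper filter meet, and a value of [f] at a common point separates the infimum
    over one from the supremum over the other. *)
Lemma limf_einf_le_esup (T : choiceType) (X : filteredType T) (R : realType)
  (f : X -> \bar R) (F : set_system X) {FF : ProperFilter F} :
  (limf_einf f F <= limf_esup f F)%E.
Proof.
rewrite limf_einfE limf_esupE; apply: ge_ereal_sup => _ [A FA <-].
apply: le_ereal_inf_tmp => _ [B FB <-].
have [x [Ax Bx]] := filter_ex (filterI FA FB).
apply: (@le_trans _ _ (f x)).
  by apply: ereal_inf_lbound; exists x.
by apply: ereal_sup_ubound; exists x.
Qed.

Lemma le_limf_einf (T : choiceType) (X : filteredType T) (R : realType)
  (f : X -> \bar R) (F : set_system X) {FF : Filter F} (l : \bar R) :
  (\forall x \near F, (l <= f x)%E) -> (l <= limf_einf f F)%E.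
Proof.
move=> lF; rewrite limf_einfE; apply: le_ereal_sup_tmp.
exists (ereal_inf (f @` [set x | (l <= f x)%E])); first by exists [set x | (l <= f x)%E].
by apply: le_ereal_inf_tmp => _ [x lx <-].
Qed.

Lemma limf_esup_le (T : choiceType) (X : filteredType T) (R : realType)
  (f : X -> \bar R) (F : set_system X) {FF : Filter F} (l : \bar R) :
  (\forall x \near F, (f x <= l)%E) -> (limf_esup f F <= l)%E.
Proof.
move=> lF; rewrite limf_esupE; apply: ge_ereal_inf.
exists (ereal_sup (f @` [set x | (f x <= l)%E])); first by exists [set x | (f x <= l)%E].
by apply: ge_ereal_sup => _ [x lx <-].
Qed.

(** * Scaling of both bounds in the size [l] of the initial data *)

Unset Implicit Arguments.

Theorem theorem1p3 (R : realType) (V : choiceType) (G : wgraph R V)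
  (V_infinite : infinite_set [set: V])
  (G_locally_finite : locally_finite G)
  (G_connected : connected_graph G)
  (omega_min_gt0 : (0 < omega_min G)%E)
  (D_mu_fin : (D_mu G < +oo)%E)
  (p : R) (p_gt1 : 1 < p)
  (psi : V -> R)
  (psi_ge0 : forall x, 0 <= psi x)
  (psi_bounded : exists M : R, forall x, psi x <= M)
  (psi_neq0 : exists x, psi x != 0)
  (x0 : V) (psi_oo : R) (psi_oo_gt0 : 0 < psi_oo)
  (HEC : EC G x0)
  (psi_lim : tends_at_infinity G x0 psi psi_oo) :
  let T (l : R) : \bar R := life_span G p (fun x => l * psi x) in
  let scaled_T (l : R) : \bar R := ((l `^ (p - 1))%:E * T l)%E in
  [/\ forall l : R, 0 < l ->
        (T l <= (((p - 1) * l `^ (p - 1) * psi_oo `^ (p - 1))^-1)%:E)%E,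
      (forall x, psi x <= psi_oo) ->
        scaled_T l @[l --> 0^'+] --> (((p - 1) * psi_oo `^ (p - 1))^-1)%:E
    & [/\ ((((p - 1) * sup_norm psi `^ (p - 1))^-1)%:E
             <= limf_einf scaled_T 0^'+)%E,
          (limf_einf scaled_T 0^'+ <= limf_esup scaled_T 0^'+)%E
        & (limf_esup scaled_T 0^'+
             <= (((p - 1) * psi_oo `^ (p - 1))^-1)%:E)%E]].
Proof.
move=> T scaled_T.
have q0 : 0 < p - 1 by rewrite subr_gt0.
have lq0 (l : R) : 0 < l -> l `^ (p - 1) != 0.
  by move=> l0; rewrite gt_eqF// powR_gt0.
have upper l : 0 < l ->
    (T l <= (((p - 1) * l `^ (p - 1) * psi_oo `^ (p - 1))^-1)%:E)%E.
  (* The data [l * psi] tends to [l * psi_oo] at infinity, so the general bound applies with that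
     limit. *)
  move=> l0; rewrite -mulrA -powRM ?(ltW l0) ?(ltW psi_oo_gt0)//.
  apply: (life_span_le G_locally_finite HEC p_gt1); last by rewrite mulr_gt0.
  move=> e e0; have [N psiN] := psi_lim _ (divr_gt0 e0 l0).
  exists N => x /psiN; rewrite ltr_pdivlMr// -mulrBr normrM (gtr0_norm l0).
  by rewrite mulrC.
have scaled_upper l : 0 < l ->
    (scaled_T l <= (((p - 1) * psi_oo `^ (p - 1))^-1)%:E)%E.
  move=> l0; have := lee_wpmul2l _ (upper l l0).
  move=> /(_ (l `^ (p - 1))%:E); rewrite lee_fin powR_ge0 => /(_ erefl).
  move/le_trans; apply; rewrite -EFinM lee_fin le_eqVlt; apply/orP; left.
  apply/eqP; field; rewrite !lq0//= gt_eqF//.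
(* [M] is left free: it becomes [psi_oo] in the second claim and [sup_norm psi] in the third. *)
have scaled_lower M l : 0 < M -> (forall x, psi x <= M) -> 0 < l ->
    ((((p - 1) * M `^ (p - 1))^-1)%:E <= scaled_T l)%E.
  move=> M0 psiM l0.
  have : ((((p - 1) * (l * M) `^ (p - 1))^-1)%:E <= T l)%E.
    apply: life_span_ge => // [|x]; first by rewrite mulr_gt0.
    by rewrite mulr_ge0 ?(ltW l0)//= ler_wpM2l// ltW.
  move=> /(lee_wpmul2l (x := (l `^ (p - 1))%:E)).
  rewrite lee_fin powR_ge0 => /(_ erefl); apply: le_trans.
  rewrite -EFinM lee_fin powRM ?(ltW l0) ?(ltW M0)// le_eqVlt; apply/orP; left.
  apply/eqP; field; rewrite !lq0//= gt_eqF//.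
(* Boundedness matters here, since [sup] defaults to 0 on unbounded sets. *)
have psi_sup x : psi x <= sup_norm psi.
  have [M psiM] := psi_bounded.
  apply: le_trans (ler_norm _) _; apply: ub_le_sup; last by exists x.
  by exists M => _ [y _ <-]; rewrite ger0_norm.
have sup0 : 0 < sup_norm psi.
  have [x psix] := psi_neq0; apply: lt_le_trans (psi_sup x).
  by rewrite lt_neqAle eq_sym psix psi_ge0.
split=> //.
  (* With [M = psi_oo] the two bounds coincide, so [scaled_T] is constant for [l > 0]. *)
  move=> psi_le; apply: cvg_near_cst; near=> l.
  have l0 : 0 < l by [].
  by apply/eqP; rewrite eq_le scaled_upper// scaled_lower.
split.
- by apply: le_limf_einf; near=> l; exact: scaled_lower.
- exact: limf_einf_le_esup.
- by apply: limf_esup_le; near=> l; exact: scaled_upper.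
Unshelve. all: by end_near. Qed.
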